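(* Let $\mathcal{A}$ be a zero product determined $\star$-algebra over $\mathbb{C}$ with unity $1$, and let $\varphi : \mathcal{A} \to \mathcal{A}$ be a linear map. Then the following conditions are equivalent: (i) $\varphi$ is a right centralizer, i.e. $\varphi(ab) = a\varphi(b)$ for all $a, b \in \mathcal{A}$; (ii) for all $a, b \in \mathcal{A}$, if $a^\star b = 0$ then $\varphi(a)^\star b = 0$.
   Context: All algebras and vector spaces are over the complex field $\mathbb{C}$; algebras are associative. A $\star$-algebra is an algebra equipped with a conjugate-linear involution $a \mapsto a^\star$ satisfying $(ab)^\star = b^\star a^\star$ and $(a^\star)^\star = a$. A linear map $\varphi : \mathcal{A} \to \mathcal{A}$ is a right centralizer if $\varphi(ab) = a\varphi(b)$ for all $a, b \in \mathcal{A}$. For an algebra $\mathcal{A}$, $\mathcal{A}^2$ denotes the linear span of all products $ab$ with $a,b \in \mathcal{A}$. The algebra $\mathcal{A}$ is called zero product determined if for every linear space $\mathcal{X}$ and every bilinear map $\phi : \mathcal{A} \times \mathcal{A} \to \mathcal{X}$ the following holds: if $\phi(a,b) = 0$ whenever $ab = 0$, then there exists a linear map $T : \mathcal{A}^2 \to \mathcal{X}$ such that $\phi(a,b) = T(ab)$ for all $a, b \in \mathcal{A}$. *)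

(* Defs.v *)
From HB Require Import structures.
From mathcomp Require Import all_boot all_order all_algebra.
From mathcomp Require Import boolp reals.
From mathcomp Require Import complex.

Set Implicit Arguments.
Unset Strict Implicit.
Unset Printing Implicit Defensive.

Import GRing.Theory Num.Theory.
Local Open Scope ring_scope.

(* The library's algType requires a unity with 1 != 0. Associative algebras are
   neither assumed unital nor nonzero here, hence a product on an lmodType. *)
HB.mixin Record Lmodule_isAssocAlgebra (C : nzRingType) A
    of GRing.Lmodule C A := {
  amul : A -> A -> A;
  amulA : associative amul;
  amulDl : forall x y z : A, amul (x + y) z = amul x z + amul y z;
  amulDr : forall x y z : A, amul x (y + z) = amul x y + amul x z;
  amulZl : forall (c : C) (x y : A), amul (c *: x) y = c *: amul x y;
  amulZr : forall (c : C) (x y : A), amul x (c *: y) = c *: amul x y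
}.

#[short(type="assocAlgType")]
HB.structure Definition AssocAlgebra (C : nzRingType) :=
  {A of GRing.Lmodule C A & Lmodule_isAssocAlgebra C A}.

Notation "x ** y" := (amul x y) (at level 40, left associativity) : ring_scope.

HB.mixin Record AssocAlgebra_hasStar (C : numClosedFieldType) A
    of AssocAlgebra C A := {
  star : A -> A;
  starD : forall x y : A, star (x + y) = star x + star y;
  starZ : forall (c : C) (x : A), star (c *: x) = c^* *: star x;
  starM : forall x y : A, star (x ** y) = star y ** star x;
  starK : involutive star
}.

#[short(type="starAlgType")]
HB.structure Definition StarAlgebra (C : numClosedFieldType) :=
  {A of AssocAlgebra C A & AssocAlgebra_hasStar C A}.

Section SquareSpace.
Variables (C : nzRingType) (A : assocAlgType C).

Definition sq_space : {pred A} := fun x : A =>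
  `[< exists (n : nat) (c : 'I_n -> C) (a b : 'I_n -> A),
        x = \sum_(i < n) c i *: (a i ** b i) >].

Fact sq_space_submod_closed : submod_closed sq_space.
Proof.
split.
  apply/asboolP; exists 0%N, (fun=> 0), (fun=> 0), (fun=> 0).
  by rewrite big_ord0.
move=> k u v /asboolP[n [c [a [b ->]]]] /asboolP[m [d [e [f ->]]]].
apply/asboolP; exists (n + m)%N.
exists (fun i => match split i with inl j => k * c j | inr j => d j end).
exists (fun i => match split i with inl j => a j | inr j => e j end).
exists (fun i => match split i with inl j => b j | inr j => f j end).
rewrite big_split_ord /= scaler_sumr; congr (_ + _); apply: eq_bigr => i _.
  by rewrite -[lshift m i]/(unsplit (inl i)) unsplitK scalerA.
by rewrite -[rshift n i]/(unsplit (inr i)) unsplitK.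
Qed.

HB.instance Definition _ :=
  GRing.isSubmodClosed.Build C A sq_space sq_space_submod_closed.

Inductive sq_of : predArgType := SqOf x & x \in sq_space.

Definition sqval u := let: SqOf x _ := u in x.

HB.instance Definition _ := [isSub of sq_of for sqval].
HB.instance Definition _ := [Choice of sq_of by <:].
HB.instance Definition _ := [SubChoice_isSubZmodule of sq_of by <:].
HB.instance Definition _ := [SubZmodule_isSubLmodule of sq_of by <:].

Fact amul_sq_space (a b : A) : a ** b \in sq_space.
Proof.
apply/asboolP; exists 1%N, (fun=> 1), (fun=> a), (fun=> b).
by rewrite big_ord1 scale1r.
Qed.

Definition amul_sq (a b : A) : sq_of := SqOf (amul_sq_space a b).

Definition zero_product_determined : Prop :=
  forall (X : lmodType C) (f : {bilinear A -> A -> X}),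
    (forall a b : A, a ** b = 0 -> f a b = 0) ->
    exists T : {linear sq_of -> X}, forall a b : A, f a b = T (amul_sq a b).

Definition right_centralizer (phi : {linear A -> A}) : Prop :=
  forall a b : A, phi (a ** b) = a ** phi b.

End SquareSpace.

Arguments sq_of {C} A.
Arguments zero_product_determined {C} A.

(* Main.v *)
(* The bilinear map (a, b) |-> star (phi (star a)) ** b kills zero products, so
   it factors through a ** b. Comparing its values at (star a, 1) and (1, star a)
   gives star (phi a) = star (phi (star 1)) ** star a, that is
   phi a = a ** phi (star 1). *)
From HB Require Import structures.
Require Import Defs.
From mathcomp Require Import all_boot all_order all_algebra.
From mathcomp Require Import boolp reals.
From mathcomp Require Import complex.

Local Open Scope ring_scope.

Import GRing.Theory Num.Theory.

Lemma amul0r (C : nzRingType) (A : assocAlgType C) (x : A) : x ** 0 = 0.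
Proof. by apply: (addrI (x ** 0)); rewrite -amulDr !addr0. Qed.

Section StarConjugate.
Variables (C : numClosedFieldType) (A : starAlgType C) (phi : {linear A -> A}).

(** The two stars conjugate scalars twice, which makes the map linear rather than conjugate-linear
    in [a]. *)
Definition star_conjugate_mul (a b : A) : A := star (phi (star a)) ** b.

Fact star_conjugate_mul_bilinear :
  bilinear_for *:%R *:%R star_conjugate_mul.
Proof.
rewrite /star_conjugate_mul; split=> [b k x y|a k x y] /=.
  by rewrite starD starZ linearP starD starZ conjCK amulDl amulZl.
by rewrite amulDr amulZr.
Qed.

HB.instance Definition _ := bilinear_isBilinear.Build C A A A *:%R *:%R
  star_conjugate_mul star_conjugate_mul_bilinear.

End StarConjugate.

Theorem theorem2p2 (R : realType) (A : starAlgType R[i])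
    (hA : zero_product_determined A)
    (one : A) (one_left : forall a : A, one ** a = a)
    (one_right : forall a : A, a ** one = a)
    (phi : {linear A -> A}) :
  right_centralizer phi <->
  (forall a b : A, star a ** b = 0 -> star (phi a) ** b = 0).
Proof.
split=> [phiM a b ab0|phi0].
  (* Since [phi a = a ** phi one], the product [star (phi a) ** b] has [star a ** b] as right
     factor. *)
  rewrite -(one_right a) phiM starM -amulA ab0.
  exact: amul0r.
have [a b ab0|T fT] := hA A (star_conjugate_mul _ _ phi).
  by apply: phi0; rewrite starK.
have phiE a : phi a = a ** phi (star one).
  apply: (can_inj starK); rewrite starM.
  have Ta1 : amul_sq (star a) one = amul_sq one (star a).
    by apply: val_inj; rewrite /= one_left one_right.
  have := fT (star a) one; rewrite Ta1 -fT.
  by rewrite /= /star_conjugate_mul starK one_right.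
(* Right multiplication by a fixed element is a right centralizer by associativity. *)
by move=> a b; rewrite phiE [phi b]phiE amulA.
Qed.
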